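(* Let $\mathbb{K}$ be a field and let $G$ be a unicyclic graph with vertex set $V(G)=\{x_1,\ldots,x_n\}$. Let $R_G=\mathbb{K}[x_1,\ldots,x_n]$, let $NI(G)\subseteq R_G$ be the closed neighborhood ideal of $G$, and let $a_G$ be the matching number of $G$. Then $\mathrm{pd}(R_G/NI(G))\ge a_G$.
   Context: All graphs are finite and simple. A graph is unicyclic if it is connected and contains exactly one cycle. For a vertex $w$ of $G$, $N_G[w]$ denotes the closed neighborhood of $w$, i.e. $w$ together with all vertices adjacent to $w$. The vertices of $G$ are identified with the variables of $R_G=\mathbb{K}[x_1,\ldots,x_n]$ (standard grading). For $w\in V(G)$ put $m_{(G,w)}=\prod_{x_i\in N_G[w]}x_i$. The closed neighborhood ideal is $NI(G)=\langle m_{(G,w)} : w\in V(G)\rangle$. A matching of $G$ is a set of pairwise disjoint edges; the matching number $a_G$ is the maximum size of a matching. $\mathrm{pd}(R_G/I)=\max\{i:\beta_{i,j}(R_G/I)\ne 0\text{ for some }j\}$ is the projective dimension of $R_G/I$ over $R_G$, where $\beta_{i,j}$ denotes graded Betti numbers. *)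

(* Defs.v *)
From HB Require Import structures.
From mathcomp Require Import all_boot all_order all_algebra.
From mathcomp Require Import mpoly.

Set Implicit Arguments.
Unset Strict Implicit.
Unset Printing Implicit Defensive.

Import GRing.Theory.

Local Open Scope ring_scope.

(** * Graphs: a simple graph on the vertex set 'I_n is a symmetric irreflexive
    relation on 'I_n. *)

Section Graphs.

Variables (n : nat) (e : rel 'I_n).

Definition simple_graph : Prop := ssrbool.symmetric e /\ irreflexive e.

Definition connected_graph : Prop := forall x y : 'I_n, connect e x y.

Definition edges : {set {set 'I_n}} :=
  [set [set p.1; p.2] | p : 'I_n * 'I_n & e p.1 p.2].

(** A cycle is a subgraph, given here by its edge set, so that the different
    cyclic orderings of its vertices all describe the same cycle. *)
Definition cycle_edges (s : seq 'I_n) : {set {set 'I_n}} :=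
  [set [set x; next s x] | x in s].

Definition is_cycle (C : {set {set 'I_n}}) : Prop :=
  exists s : seq 'I_n, [/\ (2 < size s)%N, ucycle e s & C = cycle_edges s].

Definition unicyclic : Prop :=
  connected_graph /\ exists! C : {set {set 'I_n}}, is_cycle C.

Definition is_matching (M : {set {set 'I_n}}) : bool :=
  (M \subset edges) && trivIset M.

Definition matching_number : nat := \max_(M | is_matching M) #|M|.

Definition closed_nbhd (w : 'I_n) : {set 'I_n} := [set v | (v == w) || e w v].

End Graphs.

(** * Closed neighborhood ideals *)

Definition gen_ideal (R : comNzRingType) (m : nat) (g : 'I_m -> R) (p : R) : Prop :=
  exists c : 'I_m -> R, p = \sum_(i < m) c i * g i.

Definition nbhd_monomial (K : fieldType) (n : nat) (e : rel 'I_n) (w : 'I_n) :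
  {mpoly K[n]} := \prod_(v in closed_nbhd e w) 'X_v.

Definition NI (K : fieldType) (n : nat) (e : rel 'I_n) : {mpoly K[n]} -> Prop :=
  gen_ideal (nbhd_monomial K e).

Arguments NI K {n} e p.

(** * Minimal graded free resolutions of R / I, where R = K[x_1, ..., x_n]

    The data of F encode
      F_len -> ... -> F_1 -> F_0 -> R / I,
    where F_i is the direct sum of the R(- shift i k) for k < rk i. Elements of
    F_i are row vectors and maps act by multiplication on the right; the
    augmentation F_0 -> R / I sends v to the class of v *m aug. Shifts are
    natural numbers since R / I is generated in degree 0. *)

Record free_complex (K : fieldType) (n : nat) := FreeComplex {
  len : nat;
  rk : nat -> nat;
  shift : forall i : nat, 'I_(rk i) -> nat;
  aug : 'cV[{mpoly K[n]}]_(rk 0);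
  diff : forall i : nat, 'M[{mpoly K[n]}]_(rk i.+1, rk i)
}.

Section Resolutions.

Variables (K : fieldType) (n : nat).
Implicit Types (I : {mpoly K[n]} -> Prop) (F : free_complex K n).

Definition finite_length F : Prop := forall i : nat, (len F < i)%N -> rk F i = 0%N.

(** All the maps are homogeneous of degree 0. Stated monomial by monomial, this
    also forces an entry to vanish when its expected degree is negative. *)
Definition graded F : Prop :=
  (forall (k : 'I_(rk F 0)) (m : 'X_{1..n}),
     m \in msupp (aug F k 0) -> mdeg m = shift k) /\
  (forall (i : nat) (k : 'I_(rk F i.+1)) (l : 'I_(rk F i)) (m : 'X_{1..n}),
     m \in msupp (diff F i k l) -> (mdeg m + shift l)%N = shift k).

(** The augmentation is onto R / I, and the complex is exact at F_0 and at each
    F_(i + 1). *)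
Definition resolves F I : Prop :=
  [/\ exists v : 'rV_(rk F 0), I ((v *m aug F) 0 0 - 1),
      forall v : 'rV_(rk F 0),
        I ((v *m aug F) 0 0) <-> exists w : 'rV_(rk F 1), v = w *m diff F 0
    & forall (i : nat) (v : 'rV_(rk F i.+1)),
        v *m diff F i = 0 <-> exists w : 'rV_(rk F i.+2), v = w *m diff F i.+1].

(** Every differential maps F_(i + 1) into (x_1, ..., x_n) F_i: its matrix
    entries have no constant term. *)
Definition minimal F : Prop :=
  forall (i : nat) (k : 'I_(rk F i.+1)) (l : 'I_(rk F i)),
    (diff F i k l)@_0%MM = 0.

Definition minimal_graded_free_resolution F I : Prop :=
  [/\ finite_length F, graded F, resolves F I & minimal F].

(** The graded Betti number beta_{i,j} of R / I, for F a minimal graded free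
    resolution of R / I. It does not depend on the choice of F. *)
Definition betti F (i j : nat) : nat := #|[set k : 'I_(rk F i) | shift k == j]|.

(** max {i | beta_{i,j} != 0 for some j}; only the shifts of F_i need to be tried
    as values of j, see [betti_neq0P]. *)
Definition projdim F : nat :=
  \max_(i < (len F).+1 | [exists k : 'I_(rk F i), betti F i (shift k) != 0%N]) i.

Lemma betti_neq0P F (i : nat) :
  reflect (exists j : nat, betti F i j != 0%N)
          [exists k : 'I_(rk F i), betti F i (shift k) != 0%N].
Proof.
apply: (iffP existsP) => [[k nz_k]|[j nz_j]]; first by exists (shift k).
have [k] : exists k, k \in [set k : 'I_(rk F i) | shift k == j].
  by apply/set0Pn; rewrite -cards_eq0.
by rewrite inE => /eqP kj; exists k; rewrite kj.
Qed.

Lemma leq_projdim F (i j : nat) :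
  finite_length F -> betti F i j != 0%N -> (i <= projdim F)%N.
Proof.
move=> finF nz_ij; have lt_i : (i < (len F).+1)%N.
  rewrite ltnS leqNgt; apply/negP => /finF rk0; case/negP: nz_ij.
  by rewrite /betti -leqn0 -[X in (_ <= X)%N]rk0 -[X in (_ <= X)%N]card_ord max_card.
apply: (@leq_bigmax_cond _ _ (fun i : 'I_(len F).+1 => i : nat) (Ordinal lt_i)).
by apply/betti_neq0P; exists j.
Qed.

End Resolutions.

(* Main.v *)
(** A unicyclic graph has an independent set of size at least [n./2], hence at
    least its matching number: deleting a vertex of the cycle leaves a forest,
    and in a forest taking a leaf and discarding its neighbor, repeatedly,
    selects at least half of the vertices. A maximum independent set S is
    dominating, so the product u of the variables outside S is not in NI(G),
    while [x_w u] is in NI(G) for every w in S. Thus (x_w : w in S) is an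
    associated prime of R / NI(G), generated by a regular sequence of length
    #|S|, and this forces F_#|S| to be nonzero in every free resolution. *)

Require Import Defs.
From mathcomp Require Import all_boot all_order all_algebra.
From mathcomp Require Import mpoly.
From mathcomp Require Import zify ring.

Set Implicit Arguments.
Unset Strict Implicit.
Unset Printing Implicit Defensive.

Import GRing.Theory.

Local Open Scope ring_scope.

(** * Regular sequences modulo an ideal, and socle elements of exact complexes *)

Section RegularSequences.

Variable A : comNzRingType.
Implicit Types (J : A -> Prop) (y a b : A).

Definition ideal J : Prop :=
  [/\ J 0, forall a b, J a -> J b -> J (a + b) & forall a b, J b -> J (a * b)].

(** The ideal [J + (y)]. *)
Definition adjoin J y a : Prop := exists c, J (a - y * c).

Fixpoint regular_sequence J (ys : seq A) : Prop :=
  if ys is y :: ys' then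
    (forall a, J (y * a) -> J a) /\ regular_sequence (adjoin J y) ys'
  else True.

(** Entrywise congruence modulo [J] stands for equality over [A / J], so that all matrices keep
    entries in [A]. *)
Definition mx_in J m n (M : 'M[A]_(m, n)) : Prop := forall i j, J (M i j).

Lemma ideal_adjoin J y : ideal J -> ideal (adjoin J y).
Proof.
move=> [J0 JD JM]; split.
- by exists 0; rewrite mulr0 subrr.
- move=> a b [c Jc] [d Jd]; exists (c + d).
  by have := JD _ _ Jc Jd; congr J; ring.
- move=> a b [c Jc]; exists (a * c).
  by have := JM a _ Jc; congr J; ring.
Qed.

Lemma mx_inD J m n (M N : 'M[A]_(m, n)) :
  ideal J -> mx_in J M -> mx_in J N -> mx_in J (M + N).
Proof. by move=> [_ JD _] JM JN i j; rewrite mxE; apply: JD. Qed.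

Lemma mx_inZ J m n a (M : 'M[A]_(m, n)) :
  ideal J -> mx_in J M -> mx_in J (a *: M).
Proof. by move=> [_ _ JM] JN i j; rewrite mxE; apply: JM. Qed.

Lemma mx_inB J m n (M N : 'M[A]_(m, n)) :
  ideal J -> mx_in J M -> mx_in J N -> mx_in J (M - N).
Proof.
by move=> idJ JM JN; rewrite -scaleN1r; apply: mx_inD => //; apply: mx_inZ.
Qed.

Lemma mx_in_mul J m n p (M : 'M[A]_(m, n)) (N : 'M[A]_(n, p)) :
  ideal J -> mx_in J M -> mx_in J (M *m N).
Proof.
move=> [J0 JD JM] MJ i j; rewrite mxE; apply: (big_ind J) => // k _.
by rewrite mulrC; apply: JM.
Qed.

Lemma mx_in_adjoin J y m n (M : 'M[A]_(m, n)) :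
  mx_in (adjoin J y) M <-> exists C : 'M[A]_(m, n), mx_in J (M - y *: C).
Proof.
split=> [MJ | [C MJ] i j]; last by exists (C i j); have := MJ i j; rewrite !mxE.
have [C CP] : exists C : forall k : 'I_m * 'I_n, A,
    forall k, J (M k.1 k.2 - y * C k).
  apply: (@fin_all_exists _ (fun=> A) (fun k c => J (M k.1 k.2 - y * c))) => k.
  exact: MJ.
by exists (\matrix_(i, j) C (i, j)) => i j; rewrite !mxE; apply: (CP (i, j)).
Qed.

(* [Tor_s(coker d_0, A / (ys)) = 0] when [F_s = 0]. If [y u = d_0 w], then [w]
   is a socle element of the complex shifted by one and reduced modulo [y],
   which is exact because [y] is regular. *)
Lemma socle_eq0 (ys : seq A) J (rk : nat -> nat)
    (d : forall i, 'M[A]_(rk i.+1, rk i)) (u : 'rV[A]_(rk 0)) :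
    ideal J -> regular_sequence J ys ->
    (forall i, d i.+1 *m d i = 0) ->
    (forall i (v : 'rV_(rk i.+1)), mx_in J (v *m d i) ->
       exists w, mx_in J (v - w *m d i.+1)) ->
    rk (size ys) = 0%N ->
    (forall y, y \in ys -> exists w, mx_in J (y *: u - w *m d 0)) ->
  exists w, mx_in J (u - w *m d 0).
Proof.
elim: ys J rk d u => [|y ys IH] J rk d u idJ /=.
  (* Here [rk 0 = 0], so [u] has no entries. *)
  move=> _ _ _ rk0 _; exists 0 => i j.
  by have : (j < 0)%N by rewrite -[X in (_ < X)%N]rk0.
move=> [regy regys] dd exact_d rk0 socle.
have regyM m n (M : 'M[A]_(m, n)) : mx_in J (y *: M) -> mx_in J M.
  by move=> JM i j; apply: regy; have := JM i j; rewrite mxE.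
have [w Jw] := socle y (mem_head _ _).
have [i|i v|//|z z_ys|q /mx_in_adjoin[c Jc]] :=
  IH (adjoin J y) (fun i => rk i.+1) (fun i => d i.+1) w
     (ideal_adjoin y idJ) regys.
- exact: dd.
(* Modulo [J], [v *m d i.+1 = y *: c] gives [y *: (c *m d i) = 0]. Cancelling [y], [c] is a boundary
   [t *m d i.+1], and [v - y *: t] is a cycle. *)
- case/mx_in_adjoin=> c Jc.
  have /exact_d[t Jt] : mx_in J (c *m d i).
    apply: regyM; have := mx_in_mul (- d i) idJ Jc.
    congr (mx_in J _); rewrite mulmxN mulmxBl -mulmxA dd mulmx0 sub0r opprK.
    by rewrite scalemxAl.
  have /exact_d[t' Jt'] : mx_in J ((v - y *: t) *m d i.+1).
    have := mx_inD idJ Jc (mx_inZ y idJ Jt); congr (mx_in J _).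
    by rewrite scalerBr addrA subrK mulmxBl scalemxAl.
  exists t'; apply/mx_in_adjoin; exists t; move: Jt'; congr (mx_in J _).
  by rewrite addrAC.
(* With [z *: u = w' *m d 0] and [y *: u = w *m d 0] modulo [J], the row [z *: w - y *: w'] is a
   cycle, hence a boundary. *)
- have [|w' Jw'] := socle z; first by rewrite inE z_ys orbT.
  have /exact_d[t Jt] : mx_in J ((z *: w - y *: w') *m d 0).
    have := mx_inB idJ (mx_inZ y idJ Jw') (mx_inZ z idJ Jw); congr (mx_in J _).
    rewrite mulmxBl -!scalemxAl; move: (w *m _) (w' *m _) => a b.
    by apply/matrixP=> i j; rewrite !mxE; ring.
  exists t; apply/mx_in_adjoin; exists w'; move: Jt; congr (mx_in J _).
  by rewrite addrAC.
(* Modulo [J], [w = q *m d 1 + y *: c], so [y *: u = y *: (c *m d 0)], and [y] cancels. *)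
exists c; apply: regyM.
have := mx_inD idJ Jw (mx_in_mul (d 0) idJ Jc); congr (mx_in J _).
rewrite !mulmxBl -mulmxA dd mulmx0 subr0 addrA subrK scalerBr.
by rewrite scalemxAl.
Qed.

End RegularSequences.

(** * Distinct variables form a regular sequence *)

Section Variables.

Variables (K : fieldType) (n : nat).
Implicit Types (T : {set 'I_n}) (p : {mpoly K[n]}).

(** The kernel of this substitution is the ideal generated by the variables in [T], so membership
    becomes an equation in a domain. *)
Definition kill_variables T p : {mpoly K[n]} :=
  p \mPo [tuple if v \in T then 0 else 'X_v | v < n].

Lemma kill_variablesC T c : kill_variables T c%:MP = c%:MP.
Proof. exact: comp_mpolyC. Qed.

Lemma kill_variablesX T v :
  kill_variables T 'X_v = if v \in T then 0 else 'X_v.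
Proof. by rewrite /kill_variables comp_mpolyXU -tnth_nth tnth_mktuple. Qed.

Lemma kill_variablesD T p q :
  kill_variables T (p + q) = kill_variables T p + kill_variables T q.
Proof. exact: comp_mpolyD. Qed.

Lemma kill_variablesB T p q :
  kill_variables T (p - q) = kill_variables T p - kill_variables T q.
Proof. exact: comp_mpolyB. Qed.

Lemma kill_variablesM T p q :
  kill_variables T (p * q) = kill_variables T p * kill_variables T q.
Proof. exact: rmorphM. Qed.

Lemma mpoly_ring_ind (P : {mpoly K[n]} -> Prop) :
    (forall c, P c%:MP) -> (forall v, P 'X_v) ->
    (forall p q, P p -> P q -> P (p + q)) ->
    (forall p q, P p -> P q -> P (p * q)) ->
  forall p, P p.
Proof.
move=> PC PX PD PM; elim/mpolyind => [|c m p _ _ Pp]; first by rewrite -mpolyC0.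
apply: PD => //; rewrite -mul_mpolyC; apply: (PM _ _ (PC c)).
rewrite mpolyXE_id; apply: (big_ind P _ PM) => [|v _].
  by rewrite -mpolyC1.
by elim: (m v) => [|k IHk]; rewrite ?expr0 -?mpolyC1 // exprS; apply: PM.
Qed.

Lemma kill_variables_comp T U p :
  kill_variables U (kill_variables T p) = kill_variables (U :|: T) p.
Proof.
elim/mpoly_ring_ind: p => [c|v|p q|p q]; first by rewrite !kill_variablesC.
- rewrite !kill_variablesX inE; case: ifP => _.
    by rewrite orbT -mpolyC0 kill_variablesC.
  by rewrite kill_variablesX orbF.
- by rewrite !kill_variablesD => -> ->.
- by rewrite !kill_variablesM => -> ->.
Qed.

Lemma kill_variableE w p : exists c, p - kill_variables [set w] p = 'X_w * c.
Proof.
elim/mpoly_ring_ind: p => [c|v|p q [c cP] [d dP]|p q [c cP] [d dP]].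
- by exists 0; rewrite kill_variablesC subrr mulr0.
- rewrite kill_variablesX inE; case: eqP => [->|_].
    by exists 1; rewrite mulr1 subr0.
  by exists 0; rewrite subrr mulr0.
- exists (c + d); rewrite kill_variablesD mulrDr -cP -dP.
  by rewrite opprD addrACA.
(* Writing [p'] and [q'] for the images, [p * q - p' * q' = (p - p') * q + p' * (q - q')]. *)
- exists (c * q + kill_variables [set w] p * d).
  by rewrite kill_variablesM mulrDr mulrA -cP mulrCA -dP; ring.
Qed.

(** The quotient by [J] embeds in a domain where ['X_w] is nonzero for [w] outside [T], and
    adjoining ['X_w] to [J] replaces [T] by [w |: T]. *)
Lemma regular_variables (J : {mpoly K[n]} -> Prop) T (s : seq 'I_n) :
    (forall p, J p <-> kill_variables T p = 0) ->
    uniq s -> {in s, forall v, v \notin T} ->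
  regular_sequence J [seq 'X_v | v <- s].
Proof.
elim: s J T => [//|w s IH] J T JP /= /andP[w_s uniq_s] sT.
have wT : w \notin T by apply: sT; rewrite mem_head.
split=> [p|].
  rewrite !JP kill_variablesM kill_variablesX (negPf wT) => /eqP.
  by rewrite mulf_eq0 -msupp_eq0 msuppX => /eqP.
apply: (IH _ (w |: T)) => // [p|v v_s]; last first.
  rewrite !inE negb_or sT ?inE ?v_s ?orbT // andbT.
  by apply: contraNneq w_s => <-.
rewrite -kill_variables_comp; split=> [[c]|p0].
  rewrite JP kill_variablesB => /eqP; rewrite subr_eq0 => /eqP ->.
  rewrite kill_variables_comp kill_variablesM kill_variablesX.
  by rewrite !inE eqxx mul0r.
(* Since [kill_variables T] is idempotent, [p] and its image, a multiple of ['X_w], agree modulo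
   [J]. *)
have [c cP] := kill_variableE w (kill_variables T p).
move: cP; rewrite p0 subr0 => cP; exists c; rewrite JP kill_variablesB.
rewrite -[kill_variables T p](_ : kill_variables T (kill_variables T p) = _).
  by rewrite cP subrr.
by rewrite kill_variables_comp setUid.
Qed.

End Variables.

(** * Independent sets in forests *)

Section Independence.

Variables (T : finType) (e : rel T).
Hypotheses (sym_e : ssrbool.symmetric e) (irr_e : irreflexive e).
Implicit Types (S W : {set T}).

Definition independent S := [forall x in S, forall y in S, ~~ e x y].

Lemma independentP S :
  reflect {in S &, forall x y, ~~ e x y} (independent S).
Proof.
apply: (iffP forall_inP) => [indS x y /indS/forall_inP xS /xS|indS x Sx] //.
by apply/forall_inP=> y; apply: indS.
Qed.

Lemma independentU1 x S :
  independent S -> {in S, forall y, ~~ e x y} -> independent (x |: S).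
Proof.
move=> /independentP indS xS; apply/independentP=> y z.
move=> /setU1P[->|Sy] /setU1P[->|Sz].
- by rewrite irr_e.
- exact: xS.
- by rewrite sym_e xS.
- exact: indS.
Qed.

(** The bound on [size s] excludes an edge walked back and forth, which [ucycle] accepts. *)
Definition acyclic W :=
  forall s : seq T, (2 < size s)%N -> ucycle e s -> ~ {subset s <= W}.

(** An end of a longest path in [W] has no neighbor in [W] off the path, and on the path only the
    next vertex, since any other would close a cycle. *)
Lemma acyclic_leaf W : acyclic W -> W != set0 ->
  exists x z, x \in W /\ {in W, forall y, e x y -> y = z}.
Proof.
move=> acycW /set0Pn[x0 Wx0].
pose P m := [exists t : m.-tuple T, [&& sorted e t, uniq t & all (mem W) t]].
have P1 : P 1%N by apply/existsP; exists [tuple x0]; rewrite /= Wx0.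
have leP m : P m -> (m <= #|T|)%N.
  case/existsP=> t /and3P[_ uniq_t _].
  by rewrite -(size_tuple t) -(card_uniqP uniq_t) max_card.
have [] := ex_maxnP (ex_intro P _ P1) leP.
move=> [|m] /existsP[t]; first by move=> _ /(_ _ P1).
case/tupleP: t => x p /and3P[/= path_p uniq_p /andP[Wx Wp]] max_m.
(* The default [x] occurs when the path is the single vertex [x], which then has no neighbor in
   [W]. *)
exists x, (head x p); split=> // y Wy exy.
have [y_p|y_p] := boolP (y \in x :: (p : seq T)); last first.
  have /max_m : P m.+2; last by rewrite ltnn.
  apply/existsP; exists [tuple of y :: x :: p].
  by move: path_p uniq_p y_p => /= -> -> ->; rewrite sym_e exy Wy Wx.
move: y_p; rewrite inE; case: eqP exy => [->|_ exy /= y_p].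
  by rewrite irr_e.
have [p1 [p2 def_p]] : exists p1 p2, tval p = p1 ++ y :: p2.
  by case/splitPr: y_p => p1 p2; exists p1, p2.
move: path_p uniq_p Wp {max_m}; rewrite {}def_p.
(* If [p1] is empty, [y] is the head of the path; otherwise the edge from [y] to [x] closes a cycle
   of length at least 3. *)
case: p1 => [//|z p1] path_p uniq_p Wp.
case: (acycW [:: x, z & rcons p1 y]).
- by rewrite /= size_rcons.
- rewrite /ucycle; apply/andP; split.
    rewrite (cycle_path x) /= last_rcons sym_e exy /=.
    by move: path_p; rewrite -cat_rcons /= cat_path => /and3P[-> ->].
  by move: uniq_p; rewrite -cons_uniq -cat_rcons -cat_cons cat_uniq => /andP[].
- apply/allP; rewrite /= Wx; move: Wp; rewrite -cat_rcons all_cat.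
  by case/andP.
Qed.

Lemma acyclic_independent W : acyclic W ->
  exists S, [/\ S \subset W, independent S & (#|W| <= #|S|.*2)%N].
Proof.
have [m] := ubnP #|W|; elim: m W => // m IH W ltWm acycW.
have [->|W_n0] := eqVneq W set0.
  exists set0; rewrite cards0; split=> //.
  by apply/independentP=> x y; rewrite inE.
have [x [z [Wx xz]]] := acyclic_leaf acycW W_n0.
pose W' := W :\ x :\ z.
have sW'W : W' \subset W by rewrite !subDset !subsetU ?subxx ?orbT.
(* Only an inequality: [z] may equal [x] or lie outside [W]. *)
have cardW : (#|W| <= #|W'|.+2)%N.
  rewrite (cardsD1 x W) Wx (cardsD1 z (W :\ x)) add1n ltnS -add1n leq_add2r.
  exact: leq_b1.
have [||S [sSW' indS cardS]] := IH W'.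
- rewrite -ltnS; apply: leq_trans ltWm; rewrite ltnS; apply: proper_card.
  by apply/properP; split=> //; exists x => //; rewrite !inE eqxx andbF.
- by move=> s s2 cyc_s sW'; apply: (acycW s) => // v /sW'; apply/subsetP.
have W'S y : y \in S -> [&& y != z, y != x & y \in W].
  by move/(subsetP sSW'); rewrite !inE.
have xS : x \notin S by apply/negP=> /W'S; rewrite eqxx andbF.
exists (x |: S); split.
- by rewrite subUset sub1set Wx (subset_trans sSW').
- apply: independentU1 => // y /W'S/and3P[yz _ Wy].
  by apply: contra yz => /(xz _ Wy)->.
- by rewrite cardsU1 xS add1n doubleS (leq_trans cardW).
Qed.

Lemma maximal_independent_dominating S :
    independent S -> (forall S', independent S' -> (#|S'| <= #|S|)%N) ->
  forall w, w \notin S -> exists2 v, v \in S & e w v.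
Proof.
move=> indS maxS w Sw; apply/exists_inP; apply: contraT.
rewrite negb_exists_in => /forall_inP wS.
by have := maxS _ (independentU1 indS wS); rewrite cardsU1 Sw add1n ltnn.
Qed.

End Independence.

(** * Matchings and independent sets in unicyclic graphs *)

Section Unicyclic.

Variables (n : nat) (e : rel 'I_n).

Lemma matching_number_le : irreflexive e -> ((matching_number e).*2 <= n)%N.
Proof.
move=> irr_e; rewrite -geq_half_double; apply/bigmax_leqP => M /andP[sME trivM].
rewrite geq_half_double -muln2 -sum_nat_const.
have /eqP : \sum_(A in M) #|A| == #|cover M| := trivM.
rewrite (eq_bigr (fun=> 2)) => [->|A /(subsetP sME)/imsetP[[x y]]].
  by rewrite -[leqRHS]card_ord max_card.
rewrite inE /= => exy ->; rewrite cards2.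
by case: eqP exy => // ->; rewrite irr_e.
Qed.

(** Take [c] on the unique cycle: a cycle avoiding [c] would have the same edge set, which contains
    an edge at [c]. *)
Lemma unicyclic_acyclicD1 :
  unicyclic e -> exists c, acyclic e (~: [set c]).
Proof.
case=> _ [C [[s [s2 cyc_s ->]] uniqC]].
case: s s2 cyc_s uniqC => // c s s2 cyc_s uniqC; exists c => t t2 cyc_t sub_t.
have eqC : cycle_edges (c :: s) = cycle_edges t by apply: uniqC; exists t.
have : [set c; next (c :: s) c] \in cycle_edges t.
  by rewrite -eqC; apply: imset_f; rewrite inE eqxx.
case/imsetP=> x t_x eq_cx.
have : c \in [set x; next t x] by rewrite -eq_cx set21.
case/set2P=> c_eq; have := sub_t c.
  by rewrite c_eq t_x !inE eqxx => /(_ isT).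
by rewrite c_eq mem_next t_x !inE eqxx => /(_ isT).
Qed.

Lemma unicyclic_independent :
    simple_graph e -> unicyclic e ->
  exists2 S : {set 'I_n}, independent e S & (matching_number e <= #|S|)%N.
Proof.
move=> [sym_e irr_e] /unicyclic_acyclicD1[c /(acyclic_independent sym_e irr_e)].
case=> S [_ indS leS]; exists S => //; move: leS.
rewrite cardsC1 card_ord; have := matching_number_le irr_e.
(* From [n.-1 <= s.*2] and [a.*2 <= n] follows [a.*2 <= s.*2.+1]; parity absorbs the deleted
   vertex. *)
by move: (matching_number e) #|S| => a s; lia.
Qed.

End Unicyclic.

(** * Nonvanishing of a term of a free resolution *)

Section ProjectiveDimension.

Variables (K : fieldType) (n : nat).
Implicit Types (I : {mpoly K[n]} -> Prop) (S : {set 'I_n}).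

(** Otherwise [socle_eq0], over the zero ideal, makes the lift [u *: v0] of [u] a boundary, which
    puts [u] in [I]. *)
Lemma resolution_rk_neq0 I S (u : {mpoly K[n]}) (F : free_complex K n) :
    ideal I -> resolves F I ->
    {in S, forall v, I ('X_v * u)} -> ~ I u ->
  rk F #|S| != 0%N.
Proof.
move=> [_ ID IM] [[v0 Iv0] exact0 exact_d] Iu nIu; apply/eqP=> rk0.
pose J (p : {mpoly K[n]}) := p = 0.
have idJ : ideal J by split=> [|p q -> ->|p q ->]; rewrite /J ?addr0 ?mulr0.
have mxJ m k (M : 'M_(m, k)) : mx_in J M <-> M = 0.
  split=> [JM|-> i j]; last by rewrite /J mxE.
  by apply/matrixP=> i j; rewrite JM mxE.
have regJ : regular_sequence J [seq 'X_v | v <- enum S].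
  apply: (@regular_variables _ _ _ set0) => [p||v _]; last 2 first.
  - exact: enum_uniq.
  - by rewrite inE.
  suff -> : kill_variables set0 p = p by [].
  rewrite -[RHS]comp_mpoly_id; congr (_ \mPo _).
  by apply: eq_from_tnth => v; rewrite !tnth_mktuple inE.
(* The augmentation sends [v0] to 1 modulo [I], so [p *: v0] lifts the class of [p]. *)
have mulIu p : I ((p *: v0 *m aug F) 0 0) <-> I p.
  rewrite -scalemxAl mxE; have Ip := IM p _ Iv0; split=> Ip'.
    by have := ID _ _ Ip' (IM (-1) _ Ip); congr I; ring.
  by have := ID _ _ Ip (IM 1 _ Ip'); congr I; ring.
have [i|i v|||w] := @socle_eq0 _ _ J (rk F) (@diff _ _ F) (u *: v0) idJ regJ.
- apply/row_matrixP=> k; rewrite row_mul row0; apply/exact_d.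
  by exists (delta_mx 0 k); rewrite rowE.
- move/mxJ/exact_d=> [w ->]; exists w; apply/mxJ; exact: subrr.
- by rewrite size_map -cardE.
- move=> _ /mapP[v + ->]; rewrite mem_enum => Sv.
  have /exact0[w def_w] : I (('X_v *: (u *: v0) *m aug F) 0 0).
    by rewrite scalerA; apply/mulIu/Iu.
  by exists w; apply/mxJ; rewrite def_w subrr.
move/mxJ/eqP; rewrite subr_eq0 => /eqP def_u.
by apply/nIu/mulIu/exact0; exists w.
Qed.

End ProjectiveDimension.

(** * Socle elements modulo the closed neighborhood ideal *)

Section NeighborhoodIdeal.

Variables (K : fieldType) (n : nat) (e : rel 'I_n).

Lemma ideal_NI : ideal (NI K e).
Proof.
split=> [|p q [c ->] [d ->]|p q [c ->]].
- by exists (fun=> 0); rewrite big1 // => i _; rewrite mul0r.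
- exists (fun i => c i + d i); rewrite -big_split /=.
  by apply: eq_bigr => i _; rewrite mulrDl.
- exists (fun i => p * c i); rewrite mulr_sumr.
  by apply: eq_bigr => i _; rewrite mulrA.
Qed.

Lemma nbhd_monomial_NI w : NI K e (nbhd_monomial K e w).
Proof.
exists (fun i => (i == w)%:R); rewrite (bigD1 w) //= eqxx mul1r.
by rewrite big1 ?addr0 // => i /negPf->; rewrite mul0r.
Qed.

(** The neighbors of [w] lie outside [S], so the monomial of [w] divides this product. *)
Lemma independent_socle (S : {set 'I_n}) : independent e S ->
  {in S, forall w, NI K e ('X_w * \prod_(v in ~: S) 'X_v)}.
Proof.
move=> /independentP indS w Sw; have [_ _ IM] := ideal_NI.
rewrite -big_setU1 ?inE ?Sw //= (big_setID (closed_nbhd e w)) /=.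
rewrite mulrC (setIidPr _); first exact/IM/nbhd_monomial_NI.
apply/subsetP=> v; rewrite !inE => /orP[->//|ewv].
by rewrite orbC (contraTN _ ewv) // => Sv; apply: indS.
Qed.

(** At the point with coordinates 0 on [S] and 1 elsewhere, all generators vanish while the product
    is 1. *)
Lemma dominating_notin_NI (S : {set 'I_n}) :
    (forall w, exists2 v, v \in S & v \in closed_nbhd e w) ->
  ~ NI K e (\prod_(v in ~: S) 'X_v).
Proof.
move=> domS [c /(congr1 (meval (fun v => (v \notin S)%:R)))].
rewrite rmorph_prod big1 /= => [|v]; last by rewrite inE mevalXU => ->.
rewrite raddf_sum big1 /= => [/eqP|w _]; first by rewrite oner_eq0.
have [v Sv wv] := domS w.
by rewrite mevalM rmorph_prod (bigD1 v) //= mevalXU Sv mul0r mulr0.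
Qed.

End NeighborhoodIdeal.

Theorem theorem3p12 (K : fieldType) (n : nat) (e : rel 'I_n)
    (simple_e : simple_graph e) (unicyclic_e : unicyclic e)
    (F : free_complex K n)
    (resF : minimal_graded_free_resolution F (NI K e)) :
  (matching_number e <= projdim F)%N.
Proof.
have [sym_e irr_e] := simple_e; have [finF _ exF _] := resF.
have [S0 indS0 leS0] := unicyclic_independent simple_e unicyclic_e.
(* A set of maximum size replaces [S0], because domination needs maximality. *)
have [S indS maxS] := @arg_maxnP _ S0 (independent e) (fun S => #|S|) indS0.
apply: (leq_trans leS0); apply: (leq_trans (maxS _ indS0)).
have domS w : exists2 v, v \in S & v \in closed_nbhd e w.
  have [Sw|] := boolP (w \in S); first by exists w; rewrite // inE eqxx.
  case/(maximal_independent_dominating sym_e irr_e indS maxS) => v Sv ewv.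
  by exists v; rewrite // inE ewv orbT.
have := resolution_rk_neq0 (ideal_NI K e) exF (independent_socle K indS)
  (dominating_notin_NI domS).
(* The shift of any basis element of [F_#|S|] is a degree with nonzero Betti number. *)
rewrite -lt0n => rk_gt0; pose k := Ordinal rk_gt0.
apply: (@leq_projdim _ _ F _ (shift k)) => //; rewrite /betti cards_eq0.
by apply/set0Pn; exists k; rewrite inE.
Qed.
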